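(* Every $\mathrm{OAE}$-partition is a $\mathcal{P}$-position of the game CRIM.
   Context: A partition is a finite weakly decreasing sequence $\lambda=[\lambda_1,\ldots,\lambda_r]$ of positive integers, called its parts; the empty partition $[\,]$ is allowed. Its conjugate is $\lambda'=[\lambda'_1,\ldots,\lambda'_{\lambda_1}]$, where $\lambda'_k$ is the largest $i$ with $\lambda_i\ge k$ (the length of the $k$-th column of the Young diagram). CRIM is the impartial two-player game whose positions are partitions. From $\lambda=[\lambda_1,\ldots,\lambda_r]$, a row move deletes the part $\lambda_i$ for some $1\le i\le r$, giving $[\lambda_1,\ldots,\lambda_{i-1},\lambda_{i+1},\ldots,\lambda_r]$. A column move takes the conjugate of the partition that results from making a row move on $\lambda'$ (i.e. it removes one column of the Young diagram). Play is normal play: the player to move at the terminal position $[\,]$ loses. A $\mathcal{P}$-position (losing position) is one from which the player who has just moved can force a win; an $\mathcal{N}$-position (winning position) is one from which the player about to move can force a win. In particular $[\,]$ is a $\mathcal{P}$-position. A partition $\lambda=[\lambda_1,\ldots,\lambda_r]$ is an $\mathrm{OAE}$-partition (odds-are-even) if $\lambda_i$ is even for every odd $i\le r$ and $\lambda'_i$ is even for every odd $i\le\lambda_1$. *)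

(* Defs.v *)
From mathcomp Require Import all_boot.

Set Implicit Arguments.
Unset Strict Implicit.
Unset Printing Implicit Defensive.

(* Partitions are 1-indexed, as in [lam_1, ..., lam_r]: part lam i is lam_i for
   1 <= i <= size lam and 0 for larger i (index 0 is meaningless and unused).
   In particular part [::] 1 = 0. *)
Definition is_partition (lam : seq nat) : bool :=
  sorted geq lam && all (fun x => 0 < x) lam.

Definition part (lam : seq nat) (i : nat) : nat := nth 0 lam i.-1.

(* The maximum is over the i in [1, size lam] with k <= lam_i; for k in
   [1, lam_1] this set contains 1, so the default value 0 never occurs. *)
Definition conjugate (lam : seq nat) : seq nat :=
  [seq \max_(1 <= i < (size lam).+1 | k <= part lam i) i
     | k <- iota 1 (part lam 1)].

Definition remove_part (i : nat) (lam : seq nat) : seq nat :=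
  take i.-1 lam ++ drop i lam.

Definition row_move (lam mu : seq nat) : Prop :=
  exists2 i, 1 <= i <= size lam & mu = remove_part i lam.

Definition column_move (lam mu : seq nat) : Prop :=
  exists2 nu, row_move (conjugate lam) nu & mu = conjugate nu.

Definition crim_move (lam mu : seq nat) : Prop :=
  row_move lam mu \/ column_move lam mu.

(* Forced wins in normal play. The definition is inductive, so a win is forced
   in finitely many moves, and a position without moves is a P-position: the
   player to move there loses. *)
Inductive P_position (T : Type) (move : T -> T -> Prop) (x : T) : Prop :=
  | P_position_intro : (forall y, move x y -> N_position move y) ->
      P_position move x
with N_position (T : Type) (move : T -> T -> Prop) (x : T) : Prop :=
  | N_position_intro y : move x y -> P_position move y -> N_position move x.

Definition OAE (lam : seq nat) : Prop :=
  (forall i, 1 <= i <= size lam -> odd i -> ~~ odd (part lam i)) /\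
  (forall i, 1 <= i <= part lam 1 -> odd i -> ~~ odd (part (conjugate lam) i)).

(* The game relation lives on all of seq nat; the lemmas below show that play
   starting from a partition only visits partitions. *)
Lemma remove_part_partition i lam :
  is_partition lam -> is_partition (remove_part i lam).
Proof.
case/andP=> s_lam p_lam; have sub : subseq (remove_part i lam) lam.
  rewrite -[X in subseq _ X](cat_take_drop i.-1 lam); apply: cat_subseq => //.
  by case: i => [|i] //=; rewrite -addn1 addnC -drop_drop drop_subseq.
apply/andP; split; last by apply/allP=> x /(mem_subseq sub); apply: (allP p_lam).
apply: subseq_sorted sub s_lam => y x z /= le_yx le_zy.
exact: leq_trans le_zy le_yx.
Qed.

Lemma conjugate_partition lam : is_partition (conjugate lam).
Proof.
apply/andP; split.
  rewrite /conjugate sorted_map.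
  apply: sub_sorted (iota_sorted 1 _) => j k le_jk /=.
  apply/bigmax_leqP_seq => i i_in le_k.
  by apply: (@leq_bigmax_seq _ _ _ id) => //; apply: leq_trans le_k.
apply/allP=> y /mapP[k]; rewrite mem_iota add1n ltnS => /andP[k_gt0 le_k] ->.
case: lam le_k => [|x lam] le_k; first by case: k k_gt0 le_k.
by apply: (@leq_bigmax_seq _ _ _ id 1); rewrite ?mem_index_iota.
Qed.

Lemma crim_move_partition lam mu :
  is_partition lam -> crim_move lam mu -> is_partition mu.
Proof.
move=> lamP [[i _ ->]|[nu _ ->]]; last exact: conjugate_partition.
exact: remove_part_partition.
Qed.

(* Main.v *)
(** Let k be odd. Column k has length #{i | lam_i >= k}, so the column condition
    says that the number of i with ceil(lam_i / 2) = m is even for each m >= 1.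
    Hence the OAE-partitions are those whose consecutive rows (1, 2), (3, 4), ...
    have lengths (2m, 2m) or (2m, 2m - 1) with m >= 1. If the opponent deletes a
    row, deleting the other row of its pair restores OAE. Column moves are
    answered in the same way, since conjugation preserves OAE. *)
Require Import Defs.
From mathcomp Require Import all_boot.

Set Implicit Arguments.
Unset Strict Implicit.
Unset Printing Implicit Defensive.

Lemma eqn_leq_gt0 m n : (forall i, 0 < i -> (i <= m) = (i <= n)) -> m = n.
Proof.
move=> eq_mn; apply/eqP; rewrite eqn_leq; apply/andP; split.
  by case: m eq_mn => // m <-.
by case: n eq_mn => // n ->.
Qed.

Lemma geq_trans : transitive geq.
Proof. by move=> y x z /= le_yx le_zy; apply: leq_trans le_yx. Qed.

(** In a weakly decreasing list the entries at least [k] form a prefix, whose length is the count.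
    Positivity of [k] makes the default 0 beyond the end fail the test. *)
Lemma ltn_count_geq k s i :
  sorted geq s -> 0 < k -> (i < count (leq k) s) = (k <= nth 0 s i).
Proof.
move=> + k_gt0; elim: s i => [|x s IHs] i /=; first by rewrite nth_nil [k <= 0]leqNgt k_gt0.
rewrite (path_sortedE geq_trans) => /andP[/allP ge_x /IHs IH].
have [le_kx|lt_xk] := leqP k x; first by case: i => [|i] /=; rewrite ?le_kx ?ltnS ?IH.
rewrite (_ : count _ _ = 0) ?ltn0; last first.
  apply/eqP; rewrite -leqn0 leqNgt -has_count; apply/hasP=> -[y /ge_x le_yx le_ky].
  by move: lt_xk; rewrite ltnNge (leq_trans le_ky).
case: i => [|i] /=; first by rewrite leqNgt lt_xk.
have [/(mem_nth 0)/ge_x le_x|/(nth_default 0)->] := ltnP i (size s).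
  by apply/esym/negbTE; rewrite -ltnNge (leq_ltn_trans le_x).
by rewrite leqNgt k_gt0.
Qed.

Lemma size_conjugate lam : size (conjugate lam) = part lam 1.
Proof. by rewrite size_map size_iota. Qed.

Lemma part_conjugate lam k :
  is_partition lam -> 0 < k -> part (conjugate lam) k = count (leq k) lam.
Proof.
case/andP=> s_lam _; case: k => // k _; have cntE := @ltn_count_geq k.+1 lam _ s_lam isT.
rewrite /part /=; have [lt_k|le_k] := ltnP k (part lam 1); last first.
  rewrite nth_default ?size_conjugate //; apply/esym/eqP.
  by rewrite -leqn0 leqNgt cntE -leqNgt.
rewrite (nth_map 0) ?size_iota // nth_iota // add1n.
apply/eqP; rewrite eqn_leq; apply/andP; split.
  by apply/bigmax_leqP_seq=> -[|i] // _; rewrite -cntE.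
have c_gt0 : 0 < count (leq k.+1) lam by rewrite cntE.
apply: (@leq_bigmax_seq _ _ _ id); first by rewrite mem_index_iota c_gt0 ltnS count_size.
by rewrite /part -cntE prednK.
Qed.

(** Both sides say that the cell in row [i] and column [k] lies in the Young diagram; applied twice,
    this symmetry makes conjugation an involution. *)
Lemma leq_part_conjugate lam i k :
  is_partition lam -> 0 < i -> 0 < k ->
  (i <= part (conjugate lam) k) = (k <= part lam i).
Proof.
move=> lamP; case: i => // i _ k_gt0.
by rewrite part_conjugate // ltn_count_geq //; case/andP: lamP.
Qed.

Lemma part_conjugate1 lam : is_partition lam -> part (conjugate lam) 1 = size lam.
Proof.
by move=> lamP; rewrite part_conjugate //; apply/eqP; rewrite -all_count; case/andP: lamP.
Qed.

Lemma conjugateK lam : is_partition lam -> conjugate (conjugate lam) = lam.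
Proof.
move=> lamP; have clamP := conjugate_partition lam.
apply: (@eq_from_nth _ 0) => [|i _]; first by rewrite size_conjugate part_conjugate1.
apply: (@eqn_leq_gt0 (part _ i.+1) (part lam i.+1)) => k k_gt0.
by rewrite !leq_part_conjugate.
Qed.

Lemma OAE_conjugate lam : is_partition lam -> OAE lam -> OAE (conjugate lam).
Proof.
move=> lamP [rows cols].
by split; rewrite ?size_conjugate ?conjugateK ?part_conjugate1.
Qed.

(** The range bounds disappear because out-of-range rows and columns have length 0, which is even.
    Odd rows become even indices, as [nth] counts from 0. *)
Lemma OAE_nth_count lam :
  is_partition lam ->
  OAE lam <-> (forall i, ~~ odd i -> ~~ odd (nth 0 lam i)) /\
              (forall k, odd k -> ~~ odd (count (leq k) lam)).
Proof.
move=> lamP; split=> -[rows cols]; split.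
- move=> i ev_i; have [lt_i|/(nth_default 0)-> //] := ltnP i (size lam).
  exact: (rows i.+1).
- move=> k odd_k; have k_gt0 := odd_gt0 odd_k; rewrite -part_conjugate //.
  have [le_k|lt_k] := leqP k (part lam 1); first by apply: cols; rewrite ?k_gt0.
  by rewrite /part nth_default // size_conjugate -ltnS prednK.
- by case=> // i _ /rows.
- by move=> k /andP[k_gt0 _] odd_k; rewrite part_conjugate // cols.
Qed.

Lemma row_moveP lam mu :
  row_move lam mu <-> exists s x t, lam = s ++ x :: t /\ mu = s ++ t.
Proof.
split=> [[[|i] //= lt_i ->]|[s [x [t [-> ->]]]]].
  exists (take i lam), (nth 0 lam i), (drop i.+1 lam).
  by rewrite -drop_nth // cat_take_drop.
exists (size s).+1; first by rewrite size_cat /= addnS ltnS leq_addr.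
by rewrite /remove_part /= take_size_cat // -cat_rcons drop_size_cat ?size_rcons.
Qed.

Lemma row_move_partition lam mu : is_partition lam -> row_move lam mu -> is_partition mu.
Proof. by move=> lamP mv; apply: (crim_move_partition lamP); left. Qed.

Lemma row_move_size lam mu : row_move lam mu -> size lam = (size mu).+1.
Proof. by case/row_moveP=> s [x [t [-> ->]]]; rewrite !size_cat addnS. Qed.

Lemma row_move_part1 lam mu :
  is_partition lam -> row_move lam mu -> part mu 1 <= part lam 1.
Proof.
move=> /andP[s_lam _] /row_moveP[[|y s] [x [t [lamE ->]]]]; last by rewrite lamE.
by case: t lamE s_lam => // z t -> /= /andP[].
Qed.

Lemma OAE_pair s a t :
    is_partition (s ++ a :: t) -> OAE (s ++ a :: t) -> ~~ odd (size s) ->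
  exists b t', [/\ t = b :: t', ~~ odd a, 0 < a & a.-1 <= b <= a].
Proof.
move=> lamP /(OAE_nth_count lamP)[rows cols] ev_s; case/andP: (lamP) => s_lam /allP pos_lam.
have a_gt0 : 0 < a by apply: pos_lam; rewrite mem_cat mem_head orbT.
have ev_a : ~~ odd a by have:= rows _ ev_s; rewrite nth_cat ltnn subnn.
have odd_a1 : odd a.-1 by rewrite -[a]prednK //= negbK in ev_a.
have a1_gt0 := odd_gt0 odd_a1.
(* column [a - 1] has even length and meets row [size s + 1], so it meets the next row *)
have lt_s : size s < count (leq a.-1) (s ++ a :: t).
  by rewrite ltn_count_geq // nth_cat ltnn subnn leq_pred.
have: (size s).+1 < count (leq a.-1) (s ++ a :: t).
  rewrite ltn_neqAle lt_s andbT; apply: contra (cols _ odd_a1) => /eqP <-.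
  exact: ev_s.
rewrite ltn_count_geq // nth_cat ltnNge leqnSn subSnn /=.
(* If [t] were empty, the next entry would be the default 0, below [a.-1]. *)
case: t {pos_lam rows cols lt_s lamP} s_lam => [|b t] s_lam; first by rewrite leqNgt a1_gt0.
move=> /= le_b; exists b, t; split=> //; rewrite le_b /=.
by have := drop_sorted (size s) s_lam; rewrite drop_size_cat //= => /andP[].
Qed.

(** The rows of [t] move up by two, so their index parity is kept, and each odd column loses zero or
    two cells. *)
Lemma OAE_remove_pair s a b t :
    is_partition (s ++ [:: a, b & t]) -> is_partition (s ++ t) ->
    OAE (s ++ [:: a, b & t]) -> ~~ odd (size s) ->
  OAE (s ++ t).
Proof.
move=> lamP muP lamO ev_s.
have [c [t' [[<- _] ev_a a_gt0 /andP[le_b le_ba]]]] := OAE_pair lamP lamO ev_s.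
have [rows cols] := (OAE_nth_count lamP).1 lamO.
apply/(OAE_nth_count muP); split=> [i ev_i|k odd_k].
  have [lt_is|le_si] := ltnP i (size s).
    by have := rows i ev_i; rewrite !nth_cat lt_is.
  have := rows i.+2; rewrite /= negbK !nth_cat !ltnNge le_si !leqW //= !subSn ?leqW //.
  exact.
(* Only column [a] could meet the first row and miss the second, but [a] is even and [k] is odd. *)
have leE : (k <= b) = (k <= a).
  apply/idP/idP=> [/leq_trans-> //|le_ka]; apply: leq_trans le_b.
  rewrite -ltnS prednK // ltn_neqAle le_ka andbT.
  by apply: contraNneq ev_a => <-.
by have := cols k odd_k; rewrite !count_cat /= leE !oddD addKb.
Qed.

Lemma OAE_row_reply lam nu :
    is_partition lam -> OAE lam -> row_move lam nu ->
  exists2 mu, row_move nu mu & OAE mu.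
Proof.
move=> lamP lamO mv; have nuP := row_move_partition lamP mv.
case/row_moveP: mv => s [x [t [lamE nuE]]]; subst lam nu.
(* If [size s] is odd, the deleted [x] is the second row of its pair and its partner ends [s];
   otherwise the partner heads [t]. *)
have [odd_s|ev_s] := boolP (odd (size s)).
  case/lastP: s odd_s lamP lamO nuP => // s a.
  rewrite size_rcons !cat_rcons => ev_s lamP lamO nuP.
  have mv : row_move (s ++ a :: t) (s ++ t) by apply/row_moveP; exists s, a, t.
  exists (s ++ t) => //; apply: OAE_remove_pair lamP _ lamO ev_s.
  exact: row_move_partition mv.
have [b [t' [tE _ _ _]]] := OAE_pair lamP lamO ev_s; subst t.
have mv : row_move (s ++ b :: t') (s ++ t') by apply/row_moveP; exists s, b, t'.
exists (s ++ t') => //; apply: OAE_remove_pair lamP _ lamO ev_s.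
exact: row_move_partition mv.
Qed.

Theorem theorem1 (lam : seq nat) :
  is_partition lam -> OAE lam -> P_position crim_move lam.
Proof.
(* The number of rows plus the number of columns is invariant under conjugation, so one measure
   serves both kinds of move. *)
have [n] := ubnP (size lam + part lam 1).
elim: n lam => // n IHn lam lt_n lamP lamO.
have row_lt kap nu mu : is_partition kap -> row_move kap nu -> row_move nu mu ->
    size mu + part mu 1 < size kap + part kap 1.
  move=> kapP mv1 mv2; have nuP := row_move_partition kapP mv1.
  rewrite (row_move_size mv1) (row_move_size mv2) !addSn ltnS; apply: leqW.
  by rewrite leq_add2l (leq_trans (row_move_part1 nuP mv2)) ?row_move_part1.
split=> nu [mv1|[kap mv1 ->{nu}]].
  have [mu mv2 muO] := OAE_row_reply lamP lamO mv1.
  have nuP := row_move_partition lamP mv1.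
  exists mu; first by left.
  apply: IHn muO; last exact: row_move_partition mv2.
  exact: leq_trans (row_lt _ _ _ lamP mv1 mv2) _.
have clamP := conjugate_partition lam.
have [mu mv2 muO] := OAE_row_reply clamP (OAE_conjugate lamP lamO) mv1.
have kapP := row_move_partition clamP mv1; have muP := row_move_partition kapP mv2.
(* The reply is a column move from [conjugate kap], whose conjugate is [kap] again. *)
exists (conjugate mu); first by right; exists mu; rewrite ?conjugateK.
apply: IHn (OAE_conjugate muP muO); last exact: conjugate_partition.
rewrite size_conjugate part_conjugate1 // addnC.
apply: leq_trans (row_lt _ _ _ clamP mv1 mv2) _.
by rewrite size_conjugate part_conjugate1 // addnC.
Qed.
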